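(* For every integer $n\ge 1$, the length of the left side of the Harter–Heighway dragon curve $\mathcal C_n$, that is, the number of horizontal and vertical unit line segments on the left side of $\mathcal C_n$, equals $a_{n-1}$, where the integers $a_k$ are defined by the Taylor expansion about $x=0$ $$\frac{2(1+x^2)}{(1-x)(1-x-2x^3)}=\sum_{k=0}^{\infty}a_kx^k=2+4x+8x^2+16x^3+28x^4+48x^5+84x^6+\cdots.$$ (For $n=0$ the left side of $\mathcal C_0$ consists of $1$ segment.)
   Context: The dragon curves $\mathcal C_n$ are defined via an L-system and turtle geometry. Let $\Omega=\{A,B,+,-\}$ and let $P$ be the substitution $P(A)=A+B$, $P(B)=A-B$, $P(+)=+$, $P(-)=-$, extended letterwise to words. $\mathcal C_n$ is the lattice path in $\mathbb Z^2$ starting at $(0,0)$ obtained by reading the word $P^n(A)$ letter by letter, where $A$ means a horizontal unit move, $B$ a vertical unit move (each move continuing in the current heading), $+$ a $90^\circ$ clockwise turn without moving and $-$ a $90^\circ$ counterclockwise turn without moving; the initial heading is horizontal. Thus $\mathcal C_n$ consists of $2^n$ unit edges, with a right angle between consecutive edges. Since $\mathcal C_n$ has distinct start and end points, its boundary has a left side and a right side (relative to traversal from start to end). Equivalently the boundary is that of the polyomino $\mathcal S_n$, the union of the squares having as a diagonal an edge of $\mathcal C_n$; by earlier work, the left side of the boundary of $\mathcal S_n$ is traced (self-avoidingly) by the word $P_1^n(\mathtt R)$ of the L-system on $\{\mathtt R,\mathtt r,\mathtt L,\mathtt l,\mathtt S,\mathtt s\}$ with $\mathtt R\mapsto\mathtt{Rr}$,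 $\mathtt r\mapsto\mathtt S$, $\mathtt L\mapsto\mathtt S$, $\mathtt l\mapsto\mathtt{Ll}$, $\mathtt S\mapsto\mathtt{Rl}$, $\mathtt s\mapsto\mathtt{Lr}$ (letters $\mathtt R/\mathtt r$: right turn mid-edge, $\mathtt L/\mathtt l$: left turn, $\mathtt S/\mathtt s$: no turn; uppercase starts at an even lattice point, lowercase at an odd one). *)

(* Defs.v *)
From mathcomp Require Import all_boot all_order all_algebra.
Set Implicit Arguments. Unset Strict Implicit. Unset Printing Implicit Defensive.
Import GRing.Theory Num.Theory.

Inductive sym := SA | SB | Plus | Minus.

Definition Psub (s : sym) : seq sym :=
  match s with
  | SA => [:: SA; Plus; SB]
  | SB => [:: SA; Minus; SB]
  | Plus => [:: Plus]
  | Minus => [:: Minus]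
  end.

Definition dword (n : nat) : seq sym := iter n (fun w => flatten (map Psub w)) [:: SA].

Definition point := (int * int)%type.

(** headings: 0 = east, 1 = north, 2 = west, 3 = south (taken mod 4);
    +1 is a counterclockwise quarter turn, +3 a clockwise one *)
Definition move (p : point) (d : nat) : point :=
  match d %% 4 with
  | 0 => (p.1 + 1, p.2)%R
  | 1 => (p.1, p.2 + 1)%R
  | 2 => (p.1 - 1, p.2)%R
  | _ => (p.1, p.2 - 1)%R
  end.

Fixpoint trace (w : seq sym) (p : point) (d : nat) : seq point :=
  match w with
  | [::] => [::]
  | s :: w' =>
      match s with
      | SA | SB => let q := move p d in q :: trace w' q d
      | Plus => trace w' p (d + 3)
      | Minus => trace w' p (d + 1)
      end
  end.

Definition origin : point := (0%R, 0%R).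

Definition dverts (n : nat) : seq point := origin :: trace (dword n) origin 0.

Definition dend (n : nat) : point := last origin (dverts n).

Definition dedge (n : nat) (p q : point) : bool :=
  let vs := dverts n in
  let es := zip vs (behead vs) in
  ((p, q) \in es) || ((q, p) \in es).

(** One step of the walk along the edges of C_n that hugs the curve from its
    left side (the unbounded face kept on the walker's left): at the current
    vertex, with current heading d, take the left-most available edge of C_n
    (turn left, else go straight, else turn right, else go back). *)
Definition lstep (n : nat) (st : point * nat) : point * nat :=
  let: (p, d) := st in
  match [seq t <- [:: 1; 0; 3; 2] | dedge n p (move p (d + t))] with
  | t :: _ => (move p (d + t), (d + t) %% 4)
  | [::] => st
  end.

(** State after k unit segments of the left side.  The walk starts at the
    starting point (0,0) with fictitious incoming heading south (3), so that
    the left-most choice is the first edge of C_n (heading east). *)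
Definition lwalk (n : nat) (k : nat) : point * nat := iter k (lstep n) (origin, 3).

Definition gden : {poly int} := (1 - 'X) * (1 - 'X - 2%:R *: 'X^3).
Definition gnum : {poly int} := 2%:R *: (1 + 'X^2).

(** a is the coefficient sequence of the power series expansion of gnum/gden,
    i.e.  gden(x) * sum_k a_k x^k = gnum(x)  as formal power series. *)
Definition gf_coeffs (a : nat -> int) : Prop :=
  forall k : nat, (\sum_(i < k.+1) gden`_i * a (k - i)%N = gnum`_k)%R.

Example dend_check1 : dend 1 = (Posz 1, (- Posz 1)%R). Proof. by vm_compute. Qed.
Example lwalk_check5 : (lwalk 5 28).1 = dend 5. Proof. by vm_compute. Qed.
Example lwalk_check5' : forall j, j < 28 -> (lwalk 5 j).1 != dend 5.
Proof. by do 28 (case=> [|]; first by vm_compute); by []. Qed.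

(* Main.v *)
(** The edges of C_(n+1) arise from those of C_n by scaling by 1 - i and replacing
    every edge by two half edges forming a corner.  Traversed forward, every
    horizontal edge starts at an even point and every vertical one at an odd
    point, horizontal edges bulge to the left and vertical ones to the right.
    Hence the left-hugging walk on C_(n+1) replaces each edge of the walk on C_n
    by its two halves, with one exception: where the walk on C_n makes two left
    turns starting from a horizontal edge h, the bulges of h and of the opposite
    edge h' touch, and the walk jumps from the first half of h to the second half
    of h'.  The turn word of the walk (completed by a final right turn) is cut
    into the blocks X = RR, Y = LR, U = RLLR, V = LLRLLR, and on these the
    refinement is the substitution X -> XY, Y -> U, U -> XV, V -> YV.  The total
    length satisfies the linear recurrence of the generating function. *)

Require Import Defs.
From mathcomp Require Import all_boot all_order all_algebra.
From mathcomp Require Import zify ring.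
Import GRing.Theory.

Set Implicit Arguments. Unset Strict Implicit. Unset Printing Implicit Defensive.

(** * Directed edges and their refinement *)

(** A unit edge of the lattice, as its tail and its heading in 0, ..., 3. *)
Notation dart := (point * nat)%type.

Definition parity (p : point) : bool := odd (absz (p.1 + p.2)%R).

(** Every undirected lattice edge underlies exactly one proper dart, so parity fixes its
    orientation. *)
Definition proper (x : dart) : bool := (x.2 < 4) && (parity x.1 == odd x.2).

Definition dhead (x : dart) : point := move x.1 x.2.

Definition turn (l : bool) (x : dart) : dart :=
  (dhead x, (x.2 + (if l then 1 else 3)) %% 4).

Notation lturn := (turn true).
Notation rturn := (turn false).
Notation opp x := (lturn (lturn x)).
Notation prev x := (lturn (lturn (lturn x))).

(** The edge entering the head of [x] from the opposite side. *)
Definition flip (x : dart) : dart := (move (dhead x) x.2, (x.2 + 2) %% 4).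

(** Multiplication by 1 - i. *)
Definition phi (p : point) : point := ((p.1 + p.2)%R, (p.2 - p.1)%R).

(** [phi] rotates clockwise by 45 degrees, so the halves of an edge with heading d have headings d
    and d - 1; their order decides the side of the bulge. *)
Definition first (x : dart) : dart :=
  (phi x.1, if odd x.2 then x.2.-1 else x.2).

Definition second (x : dart) : dart :=
  (dhead (first x), if odd x.2 then x.2 else (x.2 + 3) %% 4).

Ltac dart_cases :=
  repeat match goal with x : dart, h : is_true (snd ?x < 4) |- _ =>
    let a := fresh "a" in let b := fresh "b" in let d := fresh "d" in
    revert h; destruct x as [[a b] [|[|[|[|d]]]]];
    [move=> _ | move=> _ | move=> _ | move=> _ | by []] end.

Ltac simpl_mod :=
  repeat (simpl; match goal with |- context [(?a %% 4)%N] =>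
    let v := eval vm_compute in (a %% 4)%N in change (a %% 4)%N with v end); simpl.

Lemma turnE (a b : int) :
  ((lturn (a, b, 0) = ((a + 1)%R, b, 1)) *
  (lturn (a, b, 1) = (a, (b + 1)%R, 2)) *
  (lturn (a, b, 2) = ((a - 1)%R, b, 3)) *
  (lturn (a, b, 3) = (a, (b - 1)%R, 0)) *
  (rturn (a, b, 0) = ((a + 1)%R, b, 3)) *
  (rturn (a, b, 1) = (a, (b + 1)%R, 0)) *
  (rturn (a, b, 2) = ((a - 1)%R, b, 1)) *
  (rturn (a, b, 3) = (a, (b - 1)%R, 2)))%type.
Proof. by []. Qed.

Ltac dart_eq :=
  rewrite ?turnE /second /first /turn /flip /dhead /phi /move; simpl_mod;
  repeat congr pair; try ring.

Definition vertical (x : dart) : bool := odd x.2.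

Lemma parity_phi p : parity (phi p) = false.
Proof. case: p => a b; rewrite /parity /phi /=; lia. Qed.

Lemma parity_move p d : parity (move p d) = ~~ parity p.
Proof.
case: p => a b; rewrite /parity /move /=.
by case: (d %% 4) => [|[|[|k]]] /=; lia.
Qed.

Lemma phi_inj : injective phi.
Proof. by move=> [a b] [c d] [h1 h2]; congr pair; lia. Qed.

Lemma move_mod p d : move p (d %% 4) = move p d.
Proof. by rewrite /move modn_mod. Qed.

Lemma vertical_turn l x : vertical (turn l x) = ~~ vertical x.
Proof. by rewrite /vertical /turn /=; case: l; lia. Qed.

Lemma proper_turn l x : proper x -> proper (turn l x).
Proof.
rewrite /proper /turn /dhead /= parity_move ltn_mod /=.
by case/andP=> _ /eqP ->; case: l; lia.
Qed.

Lemma proper_first x : proper x -> proper (first x).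
Proof.
by case: x => p d; rewrite /proper /= parity_phi => /andP[h _]; case: ifP; lia.
Qed.

Lemma proper_second x : proper x -> proper (second x).
Proof.
case: x => p d; rewrite /proper /second /dhead /= parity_move parity_phi.
by move=> /andP[h _]; case: ifP; lia.
Qed.

Lemma turn_second l x : proper x -> turn l (second x) = first (turn l x).
Proof. by case/andP=> h _; case: l; dart_cases; dart_eq. Qed.

Lemma lturn_first_vertical x : proper x -> vertical x -> lturn (first x) = second x.
Proof. by case/andP=> h _; dart_cases=> // _; dart_eq. Qed.

Lemma rturn_first_horizontal x : proper x -> ~~ vertical x -> rturn (first x) = second x.
Proof. by case/andP=> h _; dart_cases=> // _; dart_eq. Qed.

(** The bulges of [x] and [opp x] meet at the centre of their common left face. *)
Lemma lturn_first_horizontal x :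
  proper x -> ~~ vertical x -> lturn (first x) = second (opp x).
Proof. by case/andP=> h _; dart_cases=> // _; dart_eq. Qed.

Lemma lturn4 x : proper x -> opp (opp x) = x.
Proof. by case/andP=> h _; dart_cases=> //; dart_eq. Qed.

Lemma flip_second x : proper x -> flip (second x) = second (flip x).
Proof. by case/andP=> h _; dart_cases=> //; dart_eq. Qed.

Lemma lturn_flip x : proper x -> lturn (flip x) = rturn x.
Proof. by case/andP=> h _; dart_cases=> //; dart_eq. Qed.

Lemma flip_rturn x : proper x -> flip x = prev (rturn x).
Proof. by case/andP=> h _; dart_cases=> //; dart_eq. Qed.

Lemma flip_first x : proper x -> let l := ~~ vertical x in
  flip (first x) = first (turn l (turn l x)).
Proof. by case/andP=> h _; dart_cases=> //; dart_eq. Qed.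

Lemma proper_flip x : proper x -> proper (flip x).
Proof. by move=> h; rewrite flip_rturn //; do 4 apply: proper_turn. Qed.

(** The parity of the heading, lost under [first], is recovered from that of the tail. *)
Lemma first_inj x y : proper x -> proper y -> first x = first y -> x = y.
Proof.
case: x y => [p d] [q e] /andP[/= hd /eqP hp] /andP[/= he /eqP hq] [] /=.
move=> h1 h2 h3; have pq : p = q by apply: phi_inj; rewrite /phi h1 h2.
by move: h3; rewrite pq -hp -hq pq; case: ifP hp hq; rewrite pq => -> /= *; congr pair; lia.
Qed.

Lemma second_inj x y : proper x -> proper y -> second x = second y -> x = y.
Proof.
move=> px py e.
have e2 : lturn x = lturn y.
  by apply: first_inj; rewrite ?proper_turn // -!turn_second // e.
by rewrite -(lturn4 px) e2 lturn4.
Qed.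

Lemma first_neq_second x y : first x <> second y.
Proof.
move/(congr1 (fun z => parity z.1)).
by rewrite /= parity_move !parity_phi.
Qed.

(** * The curve as a set of directed edges *)

(** The edges of C_n, in order of traversal. *)
Definition cdarts (n : nat) : seq dart :=
  iter n (fun s => flatten [seq [:: first x; second x] | x <- s]) [:: (origin, 0)].

Definition cend (n : nat) : point := iter n phi (1%R, 0%R).

Lemma cdartsS n x : reflect (exists2 y, y \in cdarts n & x = first y \/ x = second y)
  (x \in cdarts n.+1).
Proof.
apply: (iffP flatten_mapP) => [[y hy]|[y hy h]].
  by rewrite !inE => /orP[] /eqP ->; exists y => //; [left|right].
by exists y => //; rewrite !inE; case: h => ->; rewrite eqxx ?orbT.
Qed.

Lemma proper_cdarts n x : x \in cdarts n -> proper x.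
Proof.
elim: n x => [|n IH] x; first by rewrite inE => /eqP ->.
by case/cdartsS=> y /IH hy [] ->; [apply: proper_first|apply: proper_second].
Qed.

Lemma first_cdarts n x : proper x -> (first x \in cdarts n.+1) = (x \in cdarts n).
Proof.
move=> px; apply/cdartsS/idP => [[y hy [e|/first_neq_second //]]|h].
  by rewrite (first_inj px (proper_cdarts hy) e).
by exists x; auto.
Qed.

Lemma second_cdarts n x : proper x -> (second x \in cdarts n.+1) = (x \in cdarts n).
Proof.
move=> px; apply/cdartsS/idP => [[y hy [/esym/first_neq_second //|e]]|h].
  by rewrite (second_inj px (proper_cdarts hy) e).
by exists x; auto.
Qed.

(** Prevents the walk from reaching the end early. New vertices are odd, while the refined end is
    even. *)
Lemma tail_neq_cend n x : x \in cdarts n -> x.1 != cend n.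
Proof.
elim: n x => [|n IH] x; first by rewrite inE => /eqP ->.
case/cdartsS=> y hy [] ->; first by rewrite /= (inj_eq phi_inj) IH.
apply/eqP => /(congr1 parity).
by rewrite /second /= parity_move !parity_phi.
Qed.

(** Away from the endpoints of the curve, in- and out-degrees agree at every
    vertex, and so an edge and its [flip] have both continuations or none. *)
Lemma balanced n x : x \in cdarts n -> flip x \in cdarts n ->
  (lturn x \in cdarts n) = (rturn x \in cdarts n).
Proof.
elim: n x => [|n IH] x; first by rewrite inE => /eqP ->.
case/cdartsS=> y hy [] -> {x}; have py := proper_cdarts hy; last first.
  by rewrite flip_second // !turn_second // !(first_cdarts, second_cdarts)
     ?proper_turn ?proper_flip //; apply: IH.
(* The head is a face centre: the two side edges are the second halves of the edges whose first
   halves are [first y] and its [flip], so both are present. *)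
rewrite flip_first //=.
case: (boolP (vertical y)) => oy; rewrite first_cdarts ?proper_turn // => h2.
  rewrite lturn_first_vertical // -lturn_flip ?proper_first // flip_first // oy /=.
  rewrite lturn_first_vertical ?second_cdarts ?proper_turn ?hy ?h2 //.
  by rewrite !vertical_turn oy.
by rewrite rturn_first_horizontal // lturn_first_horizontal // !second_cdarts ?proper_turn ?hy ?h2.
Qed.

(** [prev (rturn x)] is the edge straight ahead, which by [balanced] would make both side edges
    present or both absent. This serves the child [BY] of [BX], which starts on [rturn x]. *)
Lemma prev_rturn_notin n x : x \in cdarts n -> lturn x \notin cdarts n ->
  rturn x \in cdarts n -> prev (rturn x) \notin cdarts n.
Proof.
move=> hx hl hr; rewrite -flip_rturn ?(proper_cdarts hx) //.
by apply: contra hl => hf; rewrite balanced.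
Qed.

(** * Blocks of turns and their substitution *)

Inductive block := BX | BY | BU | BV.

Definition bturns (b : block) : seq bool :=
  match b with
  | BX => [:: false; false]
  | BY => [:: true; false]
  | BU => [:: false; true; true; false]
  | BV => [:: true; true; false; true; true; false]
  end.

Definition bsub (b : block) : seq block :=
  match b with
  | BX => [:: BX; BY]
  | BY => [:: BU]
  | BU => [:: BX; BV]
  | BV => [:: BY; BV]
  end.

Definition turns (ts : seq bool) (x : dart) : dart := foldl (fun y t => turn t y) x ts.

(** The dart after the last turn need not lie on the curve, which admits the fictitious turn at the
    end. *)
Fixpoint follows (n : nat) (ts : seq bool) (x : dart) : bool :=
  if ts is t :: ts' then
    [&& x \in cdarts n, t == (lturn x \in cdarts n) & follows n ts' (turn t x)]
  else true.

(** Besides the turns of the block one has to know that its first edge closes no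
    further bulge: [prev x] is the predecessor of [x] in its left face, [opp x]
    the edge of that face opposite to [x]. *)
Definition follows_block (n : nat) (b : block) (x : dart) : bool :=
  [&& ~~ vertical x, follows n (bturns b) x, prev x \notin cdarts n &
    (if b is (BX | BU) then opp x \notin cdarts n else true)].

Fixpoint follows_word (n : nat) (w : seq block) (x : dart) : bool :=
  if w is b :: w' then follows_block n b x && follows_word n w' (turns (bturns b) x)
  else x.1 == cend n.

Arguments vertical : simpl never.
Arguments turn : simpl never.
Arguments first : simpl never.
Arguments second : simpl never.
Arguments cdarts : simpl never.

Lemma vertical_first x : vertical (first x) = false.
Proof. by rewrite /vertical /first /=; case: ifP; lia. Qed.

Lemma lturn_first x : proper x ->
  lturn (first x) = second (if vertical x then x else opp x).
Proof. by move=> px; case: ifPn => h; [apply: lturn_first_vertical|apply: lturn_first_horizontal]. Qed.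

Ltac lift_simpl ex :=
  rewrite /follows_block /=;
  do 12 rewrite ?(lturn_first, rturn_first_horizontal, turn_second) ?proper_turn
    ?vertical_turn ?vertical_first ?(negbTE ex) //=;
  rewrite ?(first_cdarts, second_cdarts) ?proper_turn //.

(** Turns at old vertices are inherited through [turn_second]; those at face centres are decided by
    [lturn_first]. *)
Lemma follows_block_lift n b w x : follows_block n b x ->
  follows_word n.+1 w (first (turns (bturns b) x)) -> follows_word n.+1 (bsub b ++ w) (first x).
Proof.
move=> hb; have px : proper x.
  by case/and3P: hb => _ + _; case: b => /= /andP[/proper_cdarts].
case/and4P: hb => ex follows_b /negbTE hp hopp.
case: b follows_b hopp => /=.
- case/and4P=> h0 /eqP h1 h2 /andP[/eqP h3 _] /negbTE h5 hw.
  have /negbTE h6 := prev_rturn_notin h0 (negbT (esym h1)) h2.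
  lift_simpl ex.
  by rewrite h0 -h1 h2 -h3 hp h5 h6 hw.
- case/and4P=> h0 /eqP h1 h2 /andP[/eqP h3 _] _ hw.
  lift_simpl ex.
  by rewrite h0 -h1 -h3 hp hw.
(* The last right turn, [h6], says that [prev (rturn x)] is absent: this gives the inner right turn
   of the child [BV] and its condition on [prev]. *)
- case/and4P=> h0 /eqP h1 h2.
  case/and4P=> /eqP h3 _ /eqP h4 /and3P[_ /eqP h6 _] /negbTE h7 hw.
  lift_simpl ex.
  by rewrite h0 -h1 h2 -h3 -h4 -h6 hp h7 hw.
(* Here [opp x] is present by [h2]: the walk jumps to its second half and skips four half edges. *)
- case/and4P=> h0 /eqP h1 _ /and4P[/eqP h2 _ /eqP h3].
  case/and4P=> h4 /eqP h5 _ /and4P[/eqP h6 _ /eqP h7 _] _ hw.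
  lift_simpl ex.
  by rewrite h0 -h2 -h3 h4 -h5 -h6 -h7 ?hp hw.
Qed.

(** * Agreement with the turtle path of the L-system *)

Fixpoint wdarts (w : seq sym) (p : point) (d : nat) : seq dart :=
  match w with
  | [::] => [::]
  | SA :: w' | SB :: w' => (p, d %% 4) :: wdarts w' (move p d) d
  | Plus :: w' => wdarts w' p (d + 3)
  | Minus :: w' => wdarts w' p (d + 1)
  end.

Lemma zip_trace w p d :
  zip (p :: trace w p d) (trace w p d) = [seq (x.1, dhead x) | x <- wdarts w p d].
Proof.
elim: w p d => [//|s w IH] p d; case: s => /=; rewrite ?IH //.
all: by rewrite -IH /dhead /= move_mod.
Qed.

(** [o] and [h] are the parities of the current point and heading. *)
Fixpoint wellformed (w : seq sym) (o h : bool) : bool :=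
  match w with
  | [::] => true
  | SA :: w' => [&& ~~ o, ~~ h & wellformed w' true h]
  | SB :: w' => [&& o, h & wellformed w' false h]
  | _ :: w' => wellformed w' o (~~ h)
  end.

(** [phi] makes old vertices even, and odd points contribute an extra quarter turn, whence
    [o (+) h]. *)
Lemma wellformed_Psub w o h :
  wellformed w o h -> wellformed (flatten (map Psub w)) false (o (+) h).
Proof.
elim: w o h => [//|s w IH] o h; case: s => /= [||hw|hw].
- by case: o h => [] [] //= /IH.
- by case: o h => [] [] //= /IH.
- by rewrite -addbN IH.
- by rewrite -addbN IH.
Qed.

Lemma wellformed_dword n : wellformed (dword n) false false.
Proof. by elim: n => [//|n /wellformed_Psub]. Qed.

Lemma phi_move_even p d : ~~ odd d -> move (move (phi p) d) (d + 3) = phi (move p d).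
Proof.
case: p => a b h; rewrite -(move_mod _ (d + 3)) -modnDml -!(move_mod _ d).
have : ~~ odd (d %% 4) by rewrite odd_mod.
have : d %% 4 < 4 by rewrite ltn_mod.
case: (d %% 4) => [|[|[|[|k]]]] // _ _; rewrite /move /phi /=; congr pair; ring.
Qed.

Lemma phi_move_odd p d : odd d -> move (move (phi p) (d + 3)) d = phi (move p d).
Proof.
case: p => a b h; rewrite -(move_mod _ (d + 3)) -modnDml -!(move_mod _ d).
have : odd (d %% 4) by rewrite odd_mod.
have : d %% 4 < 4 by rewrite ltn_mod.
case: (d %% 4) => [|[|[|[|k]]]] // _ _; rewrite /move /phi /=; congr pair; ring.
Qed.

Lemma move_eqmod p d e : d = e %[mod 4] -> move p d = move p e.
Proof. by move=> h; rewrite -(move_mod _ d) h move_mod. Qed.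

(** Refining turns the heading by a further clockwise quarter at the odd points. *)
Lemma trace_Psub w p d d' : wellformed w (parity p) (odd d) ->
  d' = d + 3 * parity p %[mod 4] ->
  let w' := flatten (map Psub w) in
  wdarts w' (phi p) d' = flatten [seq [:: first x; second x] | x <- wdarts w p d] /\
  last (phi p) (trace w' (phi p) d') = phi (last p (trace w p d)).
Proof.
elim: w p d d' => [//|s w IH] p d d'; case: s => /= hw hd.
- case/and3P: hw => /negbTE hp hodd hw; rewrite hp in hd.
  have e1 : d' = d %[mod 4] by rewrite hd addn0.
  have e3 : d' + 3 = d + 3 %[mod 4] by lia.
  have e : move (move (phi p) d') (d' + 3) = phi (move p d).
    by rewrite (move_eqmod _ e1) (move_eqmod _ e3) phi_move_even.
  rewrite e; have [|| -> ->] := IH (move p d) d (d' + 3).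
  + by rewrite parity_move hp.
  + by rewrite parity_move hp.
  split=> //; congr [:: _, _ & _].
    by rewrite /first /= odd_mod // (negbTE hodd) e1.
  rewrite /second /first /dhead /= odd_mod // (negbTE hodd) e3 modnDml.
  by rewrite move_mod (move_eqmod _ e1).
- case/and3P: hw => hp hodd hw; rewrite hp in hd.
  have e1 : d' = d + 3 %[mod 4] by rewrite hd.
  have e3 : d' + 1 = d %[mod 4] by lia.
  have e : move (move (phi p) d') (d' + 1) = phi (move p d).
    by rewrite (move_eqmod _ e1) (move_eqmod _ e3) phi_move_odd.
  rewrite e; have [|| -> ->] := IH (move p d) d (d' + 1).
  + by rewrite parity_move hp.
  + by rewrite parity_move hp addn0.
  have e4 : d' = (d %% 4).-1 %[mod 4] by lia.
  split=> //; congr [:: _, _ & _].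
    by rewrite /first /= odd_mod // hodd e4 modn_small //; lia.
  rewrite /second /first /dhead /= odd_mod // hodd e3.
  by rewrite (move_eqmod _ e4).
- by apply: IH; [rewrite oddD addbT|lia].
- by apply: IH; [rewrite oddD addbT|lia].
Qed.

Lemma wdarts_dword n : wdarts (dword n) origin 0 = cdarts n /\ dend n = cend n.
Proof.
rewrite /dend /dverts /=; elim: n => [//|n [IH1 IH2]].
have [] := @trace_Psub (dword n) origin 0 0 (wellformed_dword n) (erefl _).
by rewrite IH1 IH2 /=.
Qed.

Lemma dedgeE n p d : dedge n p (move p d) =
  ((p, d %% 4) \in cdarts n) || ((move p d, (d + 2) %% 4) \in cdarts n).
Proof.
rewrite /dedge /dverts /= zip_trace (wdarts_dword n).1.
have move_inj q e e' : e < 4 -> e' < 4 -> move q e = move q e' -> e = e'.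
  case: q => a b; case: e => [|[|[|[|e]]]] //; case: e' => [|[|[|[|e']]]] // _ _;
    by case; rewrite /=; lia.
have moveK q e : move (move q e) (e + 2) = q.
  case: q => a b; rewrite -(move_mod _ (e + 2)) -modnDml -(move_mod _ e).
  have : e %% 4 < 4 by rewrite ltn_mod.
  by case: (e %% 4) => [|[|[|[|k]]]] // _; rewrite /move /=; congr pair; ring.
have E q e : ((q, move q e) \in [seq (x.1, dhead x) | x <- cdarts n]) =
    ((q, e %% 4) \in cdarts n).
  apply/mapP/idP => [[[q' e'] hx [-> /= h]]|h].
    have /andP[/= he _] := proper_cdarts hx.
    suff -> : e %% 4 = e' by [].
    by apply: (@move_inj q'); rewrite ?ltn_mod // move_mod.
  by exists (q, e %% 4); rewrite // /dhead /= move_mod.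
by rewrite -!E moveK.
Qed.

(** * The left-hugging walk *)

Definition state (x : dart) : point * nat := (dhead x, x.2).

(** By parity, a side edge at the head of [x] can only leave it and the edge straight ahead can only
    enter it. *)
Lemma lstep_state n t x : x \in cdarts n -> t = (lturn x \in cdarts n) ->
  turn t x \in cdarts n -> lstep n (state x) = state (turn t x).
Proof.
move=> hx ht htx; have px := proper_cdarts hx.
have out k : odd k -> dedge n (dhead x) (move (dhead x) (x.2 + k)) =
    ((dhead x, (x.2 + k) %% 4) \in cdarts n).
  move=> ok; rewrite dedgeE; apply: orb_idr => /proper_cdarts /andP[_].
  case/andP: px => _; rewrite /= /dhead !parity_move odd_mod // !oddD ok.
  by case: parity; case: odd.
have straight : dedge n (dhead x) (move (dhead x) (x.2 + 0)) = (flip x \in cdarts n).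
  rewrite dedgeE !addn0; apply: orb_idl => /proper_cdarts /andP[_].
  case/andP: px => _; rewrite /= /dhead !parity_move odd_mod //.
  by case: parity; case: odd.
rewrite /state /lstep /= (out 1) // (out 3) // straight.
rewrite -[(_, (x.2 + 1) %% 4)]/(lturn x) -[(_, (x.2 + 3) %% 4)]/(rturn x).
case: t ht htx => ht htx; first by rewrite -ht /dhead /= move_mod.
rewrite -ht htx; case: ifP => [hf|_]; last by rewrite /dhead /= move_mod.
(* Straight ahead is excluded: the right edge is present and the left one is not. *)
by have := balanced hx hf; rewrite -ht htx.
Qed.

Lemma follows_cat n s t x : follows n (s ++ t) x = follows n s x && follows n t (turns s x).
Proof. by elim: s x => //= a s IH x; rewrite IH !andbA. Qed.

Lemma follows_word_turns n w x : follows_word n w x ->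
  follows n (flatten (map bturns w)) x && ((turns (flatten (map bturns w)) x).1 == cend n).
Proof.
elim: w x => //= b w IH x /andP[/and3P[_ hb _] /IH /andP[h1 h2]].
by rewrite follows_cat hb h1 /turns foldl_cat.
Qed.

(** [s] stands just before the edge [x]. The last turn is never performed, so turns and edges are
    equal in number. *)
Lemma follows_lwalk n ts x s : follows n ts x -> (turns ts x).1 = cend n ->
  s.1 = x.1 -> (ts != [::] -> lstep n s = state x) ->
  (iter (size ts) (lstep n) s).1 = cend n /\
  forall j, j < size ts -> (iter j (lstep n) s).1 != cend n.
Proof.
elim: ts x s => [|t ts IH] x s /=; first by move=> _ <-.
case/and3P=> hx /eqP ht h he hs /(_ isT) hst.
have [|h1 h2] := IH (turn t x) (state x) h he (erefl _).
  by case: ts h {IH he} => // t' ts /= /andP[h' _] _; apply: lstep_state.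
split; first by rewrite -iterS iterSr hst.
by case=> [|j] hj; [rewrite /= hs tail_neq_cend|rewrite iterSr hst h2].
Qed.

(** * The length and its generating function *)

Definition bword (n : nat) : seq block := iter n (fun w => flatten (map bsub w)) [:: BX].

Lemma follows_word_bsub n w x : follows_word n w x -> follows_word n.+1 (flatten (map bsub w)) (first x).
Proof.
elim: w x => [|b w IH] x /=; first by rewrite /first /= (inj_eq phi_inj).
by case/andP=> hb /IH; apply: follows_block_lift.
Qed.

(** The induction starts at C_1, whose two edges form [BX]; hence the index shift. *)
Lemma follows_bword n : follows_word n.+1 (bword n) (origin, 0).
Proof. by elim: n => [|n /follows_word_bsub] //; vm_compute. Qed.

Definition nturns (n : nat) : nat := size (flatten (map bturns (bword n))).

Lemma lwalk_nturns n : (lwalk n.+1 (nturns n)).1 = dend n.+1 /\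
  forall j, j < nturns n -> (lwalk n.+1 j).1 != dend n.+1.
Proof.
have /andP[h /eqP he] := follows_word_turns (follows_bword n).
rewrite (wdarts_dword n.+1).2; apply: (follows_lwalk h he) => // _.
have h0 m : (origin, 0) \in cdarts m.
  by elim: m => // m; rewrite -(@first_cdarts m (origin, 0)).
(* A left turn from the fictitious heading 3 is [3 + 1], that is, east. *)
by rewrite /lstep /= (dedgeE _ _ (3 + 1)) h0.
Qed.

(** Cayley-Hamilton for the matrix of [bsub], whose characteristic polynomial is [gden] reversed.
    Lengths add over blocks, so each block is checked separately. *)
Lemma nturns_rec n :
  nturns n.+4 + nturns n.+2 + 2 * nturns n = 2 * nturns n.+3 + 2 * nturns n.+1.
Proof.
rewrite /nturns /bword !iterS -/(bword n).
elim: (bword n) => [//|b w IH].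
rewrite /= !(map_cat, flatten_cat, size_cat) /=.
by case: b; rewrite /= ?size_cat /=; lia.
Qed.

Lemma gden_coef i : (gden`_i = [:: 1; -2; 1; -2; 2]`_i :> int)%R.
Proof.
have -> : gden = (1 - 2%:R *: 'X + 'X^2 - 2%:R *: 'X^3 + 2%:R *: 'X^4)%R.
  by rewrite /gden -!mul_polyC !rmorph_nat; ring.
rewrite !coefE; case: i => [|[|[|[|[|i]]]]] //=; by rewrite nth_nil.
Qed.

Lemma gnum_coef i : (gnum`_i = [:: 2; 0; 2]`_i :> int)%R.
Proof.
by rewrite /gnum !coefE; case: i => [|[|[|i]]] //=; rewrite nth_nil.
Qed.

Lemma gf_coeffs_nturns a k : gf_coeffs a -> a k = Posz (nturns k).
Proof.
move=> ha.
have rec i : (a i.+4 = 2 * a i.+3 - a i.+2 + 2 * a i.+1 - 2 * a i)%R.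
  have := ha i.+4; rewrite gnum_coef [RHS]/=.
  (* [gden] has degree 4, so only five terms survive. *)
  do 5 rewrite big_ord_recl; rewrite big1 => [|j _]; rewrite !gden_coef /=.
    by rewrite /bump /= !subSS !subn0; lia.
  by rewrite nth_nil mul0r.
suff : [/\ a k = nturns k, a k.+1 = nturns k.+1, a k.+2 = nturns k.+2 &
  a k.+3 = nturns k.+3] by case.
elim: k => [|k [h0 h1 h2 h3]]; last first.
  by split=> //; rewrite rec h0 h1 h2 h3; have := nturns_rec k; lia.
(* The four initial values are 2, 4, 8, 16. *)
have := ha 0; have := ha 1; have := ha 2; have := ha 3.
rewrite !(big_ord_recl, big_ord0) !gnum_coef !gden_coef /= /bump /=.
rewrite /subn /= => e3 e2 e1 e0.
by split; rewrite -[RHS]/(Posz _); vm_compute (nturns _); lia.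
Qed.

Theorem theorem1 :
  forall (n : nat), 1 <= n ->
  forall a : nat -> int, gf_coeffs a ->
  exists m : nat,
    a n.-1 = Posz m /\
    (lwalk n m).1 = dend n /\
    (forall j : nat, j < m -> (lwalk n j).1 != dend n).
Proof.
case=> // n _ a ha; exists (nturns n); split; first exact: gf_coeffs_nturns.
exact: lwalk_nturns.
Qed.
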